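(* Let $\lambda\in\mathbb{C}$. The entire function $f(z)=e^z+e^{\lambda z}$ is Brody if and only if $\lambda\in\mathbb{R}$.
   Context: For an entire function $f$ the spherical derivative is $f^\#(z)=\frac{|f'(z)|}{1+|f(z)|^2}$. The function $f$ is called Brody if $f^\#$ is bounded on $\mathbb{C}$. *)

(* Defs.v *)
From Stdlib Require Import Reals.
From Coquelicot Require Import Coquelicot.

Open Scope R_scope.

(* Coquelicot has no complex exponential: exp(x + iy) = e^x (cos y + i sin y). *)
Definition Cexp (z : C) : C :=
  (exp (Re z) * cos (Im z), exp (Re z) * sin (Im z)).

(* The field [K] is forced to be [C_AbsRing], so that differentiability is
   complex differentiability and not real differentiability on the plane. *)
Definition entire (f : C -> C) : Prop :=
  forall z : C, @ex_derive C_AbsRing C_NormedModule f z.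

(* [C_derive] is a total function; it is the complex derivative wherever [f] is
   complex differentiable ([C_derive_correct]). *)
Definition spherical_derivative (f : C -> C) (z : C) : R :=
  Cmod (C_derive f z) / (1 + Cmod (f z) ^ 2).

Definition Brody (f : C -> C) : Prop :=
  entire f /\ exists M : R, forall z : C, spherical_derivative f z <= M.

(* Main.v *)
Require Import Defs.
From Stdlib Require Import Reals Lra.
From Coquelicot Require Import Coquelicot.

(** Write f(z) = e^z + e^(lambda z), so that f'(z) = e^z + lambda e^(lambda z).

    If lambda is real, the moduli a = |e^z| and b = |e^(lambda z)| depend only
    on x = Re z, and f#(z) <= (a + |lambda| b) / (1 + (a - b)^2).  For
    lambda = 1 the function is 2 e^z, which is Brody.  Otherwise
    a / b = e^((1 - lambda) x): either |x| is bounded, and so are a and b, or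
    one of a, b is at least twice the other, and then (a - b)^2 is comparable
    to the square of the larger one, which dominates the numerator
    ([Brody_quotient_bound]).

    If lambda is not real, put mu = lambda - 1.  The points z with mu z in
    i PI (2Z + 1) are zeros of f, at which f'(z) = - mu e^z.  They lie on the
    line spanned by i / mu, which is not vertical because Im mu <> 0; hence
    Re z, and with it f#(z) = |f'(z)|, is unbounded above along them
    ([spherical_derivative_at_zero]).

    The complex derivative of the exponential is obtained from the law
    e^(z+w) = e^z e^w and the first-order expansion at the origin
    ([Cexp_expansion_0]), which reduces to those of exp, cos and sin. *)

(** * The complex exponential *)

Lemma Cexp_plus (z w : C) : Cexp (z + w) = (Cexp z * Cexp w)%C.
Proof.
  destruct z as [a b], w as [c d].
  unfold Cexp, Cmult, Cplus; simpl.
  rewrite exp_plus, cos_plus, sin_plus.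
  apply injective_projections; simpl; ring.
Qed.

Lemma Cmod_Cexp (z : C) : Cmod (Cexp z) = exp (Re z).
Proof.
  unfold Cmod, Cexp; simpl fst; simpl snd.
  replace (_ + _) with (exp (Re z) ^ 2 * ((sin (Im z))² + (cos (Im z))²))
    by (unfold Rsqr; ring).
  rewrite sin2_cos2, Rmult_1_r.
  apply sqrt_pow2, Rlt_le, exp_pos.
Qed.

Lemma Cmod_le_abs_Re_Im (z : C) : Cmod z <= Rabs (Re z) + Rabs (Im z).
Proof.
  assert (hr := Rabs_pos (Re z)); assert (hi := Rabs_pos (Im z)).
  apply Rsqr_incr_0_var; [|lra].
  rewrite !Rsqr_pow2, Cmod2_alt, <- (pow2_abs (Re z)), <- (pow2_abs (Im z)).
  nra.
Qed.

Lemma Im_le_Cmod (z : C) : Rabs (Im z) <= Cmod z.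
Proof.
  eapply Rle_trans; [apply Rmax_r | apply Rmax_Cmod].
Qed.

Lemma is_derive_expansion_0 (f : R -> R) (l : R) :
  is_derive f 0 l ->
  forall eps, 0 < eps -> exists delta, 0 < delta /\
    forall h, Rabs h < delta -> Rabs (f h - f 0 - h * l) <= eps * Rabs h.
Proof.
  intros [_ H] eps heps.
  destruct (H 0 (fun P HP => HP) (mkposreal eps heps)) as [[d hd] H1].
  exists d; split; [exact hd|].
  intros h hh.
  assert (hb : ball 0 (mkposreal d hd) h).
  { change (Rabs (h - 0) < d). now rewrite Rminus_0_r. }
  specialize (H1 h hb).
  change (Rabs (f h - f 0 - (h - 0) * l) <= eps * Rabs (h - 0)) in H1.
  now rewrite Rminus_0_r in H1.
Qed.

(** With w = a + i b, the error is estimated coordinatewise from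
    e^w - 1 - w = e^a (cos b + i sin b) - 1 - a - i b, each of the three real
    functions being replaced by its own expansion. *)
Lemma Cexp_expansion_0 (eps : R) : 0 < eps ->
  exists delta, 0 < delta /\
    forall w : C, Cmod w < delta ->
      Cmod (Cexp w - 1 - w)%C <= eps * Cmod w.
Proof.
  intros heps.
  (* The two coordinates contribute at most 4 e |w| and 5 e |w|; e <= 1 tames
     the products of errors. *)
  set (e := Rmin 1 (eps / 9)).
  assert (he : 0 < e) by (apply Rmin_pos; lra).
  assert (he1 : e <= 1) by apply Rmin_l.
  assert (he2 : 9 * e <= eps).
  { assert (e <= eps / 9) by apply Rmin_r. lra. }
  assert (De : is_derive exp 0 1) by (auto_derive; [easy | rewrite exp_0; ring]).
  assert (Dc : is_derive cos 0 0) by (auto_derive; [easy | rewrite sin_0; ring]).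
  assert (Ds : is_derive sin 0 1) by (auto_derive; [easy | rewrite cos_0; ring]).
  destruct (is_derive_expansion_0 _ _ De e he) as [d1 [hd1 H1]].
  destruct (is_derive_expansion_0 _ _ Dc e he) as [d2 [hd2 H2]].
  destruct (is_derive_expansion_0 _ _ Ds e he) as [d3 [hd3 H3]].
  exists (Rmin e (Rmin d1 (Rmin d2 d3))); split.
  { now repeat (apply Rmin_pos; [assumption|]). }
  intros w hw.
  assert (hwe : Cmod w < e) by (eapply Rlt_le_trans; [exact hw | apply Rmin_l]).
  assert (hw' : Cmod w < Rmin d1 (Rmin d2 d3))
    by (eapply Rlt_le_trans; [exact hw | apply Rmin_r]).
  apply Rmin_Rgt_l in hw'; destruct hw' as [hw1 hw'].
  apply Rmin_Rgt_l in hw'; destruct hw' as [hw2 hw3].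
  assert (ha := re_le_Cmod w); assert (hb := Im_le_Cmod w).
  eapply Rle_trans; [apply Cmod_le_abs_Re_Im|].
  destruct w as [a b].
  change (Rabs a <= Cmod (a, b)) in ha; change (Rabs b <= Cmod (a, b)) in hb.
  specialize (H1 a ltac:(lra)).
  specialize (H2 b ltac:(lra)).
  specialize (H3 b ltac:(lra)).
  rewrite exp_0 in H1; rewrite cos_0 in H2; rewrite sin_0 in H3.
  set (A := exp a - 1 - a * 1) in H1.
  set (B := cos b - 1 - b * 0) in H2.
  set (D := sin b - 0 - b * 1) in H3.
  assert (hRe : Re (Cexp (a, b) - 1 - (a, b))%C = A + B * (1 + a + A))
    by (unfold A, B; simpl; ring).
  assert (hIm : Im (Cexp (a, b) - 1 - (a, b))%C = D + (a + A) * (b + D))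
    by (unfold A, D; simpl; ring).
  rewrite hRe, hIm; clear hRe hIm.
  set (m := Cmod (a, b)) in *.
  assert (hA : Rabs A <= e * m) by nra.
  assert (hB : Rabs B <= e * m) by nra.
  assert (hD : Rabs D <= e * m) by nra.
  assert (hAm : e * m <= m) by (assert (0 <= m) by apply Cmod_ge_0; nra).
  assert (hem : 0 <= e * m) by (assert (0 <= m) by apply Cmod_ge_0; nra).
  assert (hR : Rabs (A + B * (1 + a + A)) <= 4 * (e * m)).
  { eapply Rle_trans; [apply Rabs_triang|]; rewrite Rabs_mult.
    assert (Rabs (1 + a + A) <= 3).
    { eapply Rle_trans; [apply Rabs_triang|].
      assert (Rabs (1 + a) <= 1 + Rabs a).
      { eapply Rle_trans; [apply Rabs_triang|]. rewrite Rabs_R1. lra. }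
      lra. }
    assert (h0 := Rabs_pos B).
    nra. }
  assert (hI : Rabs (D + (a + A) * (b + D)) <= 5 * (e * m)).
  { eapply Rle_trans; [apply Rabs_triang|]; rewrite Rabs_mult.
    assert (h1 : Rabs (a + A) <= 2 * e)
      by (eapply Rle_trans; [apply Rabs_triang|]; lra).
    assert (h2 : Rabs (b + D) <= 2 * m)
      by (eapply Rle_trans; [apply Rabs_triang|]; lra).
    assert (h3 := Rmult_le_compat _ _ _ _ (Rabs_pos _) (Rabs_pos _) h1 h2).
    lra. }
  assert (0 <= m) by apply Cmod_ge_0.
  nra.
Qed.

(** By the addition law the expansion at [z] is [Cexp (k * z)] times the
    expansion at the origin. *)
Lemma is_derive_Cexp_scal (k z : C) :
  @is_derive C_AbsRing C_NormedModule (fun y : C => Cexp (k * y)) z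
    (k * Cexp (k * z))%C.
Proof.
  split; [apply is_linear_scal_l|].
  intros x hx [eps heps].
  assert (x = z) as ->.
  { symmetry; exact (is_filter_lim_locally_unique _ _ hx). }
  clear hx; simpl pos.
  set (c := Cmod (Cexp (k * z))); set (p := Cmod k).
  assert (hc : 0 <= c) by apply Cmod_ge_0.
  assert (hp : 0 <= p) by apply Cmod_ge_0.
  assert (hcp : 0 <= c * p) by (now apply Rmult_le_pos).
  assert (he : 0 < eps / (1 + c * p)) by (apply Rdiv_lt_0_compat; lra).
  destruct (Cexp_expansion_0 _ he) as [d [hd H]].
  assert (hd' : 0 < d / (1 + p)) by (apply Rdiv_lt_0_compat; lra).
  exists (mkposreal _ hd').
  intros y hy.
  change (Cmod (y - z)%C < d / (1 + p)) in hy.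
  change (Cmod (Cexp (k * y) - Cexp (k * z) - (y - z) * (k * Cexp (k * z)))%C
          <= eps * Cmod (y - z)%C).
  set (h := (y - z)%C) in *.
  assert (hh : 0 <= Cmod h) by apply Cmod_ge_0.
  replace (k * y)%C with (k * z + k * h)%C by (unfold h; ring).
  rewrite Cexp_plus.
  replace (_ - _ - _)%C with (Cexp (k * z) * (Cexp (k * h) - 1 - k * h))%C
    by ring.
  rewrite Cmod_mult; fold c.
  assert (hkh : Cmod (k * h)%C < d).
  { rewrite Cmod_mult; fold p.
    apply (Rmult_lt_compat_r (1 + p)) in hy; [|lra].
    unfold Rdiv in hy; rewrite Rmult_assoc, Rinv_l, Rmult_1_r in hy by lra.
    nra. }
  specialize (H _ hkh); rewrite Cmod_mult in H; fold p in H.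
  apply Rle_trans with (c * (eps / (1 + c * p) * (p * Cmod h))).
  { now apply Rmult_le_compat_l. }
  replace (c * _) with (eps * Cmod h * (c * p / (1 + c * p)))
    by (field; lra).
  assert (c * p / (1 + c * p) <= 1) by (apply Rle_div_l; lra).
  assert (0 <= eps * Cmod h) by (apply Rmult_le_pos; lra).
  nra.
Qed.

Lemma is_derive_exp_sum (lambda z : C) :
  @is_derive C_AbsRing C_NormedModule
    (fun y : C => (Cexp y + Cexp (lambda * y))%C) z
    (Cexp z + lambda * Cexp (lambda * z))%C.
Proof.
  apply (@is_derive_plus C_AbsRing C_NormedModule);
    [|apply is_derive_Cexp_scal].
  assert (H := is_derive_Cexp_scal 1 z).
  rewrite !Cmult_1_l in H.
  apply is_derive_ext with (2 := H).
  intros y; now rewrite Cmult_1_l.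
Qed.

Lemma spherical_derivative_exp_sum (lambda z : C) :
  spherical_derivative (fun y : C => (Cexp y + Cexp (lambda * y))%C) z =
  Cmod (Cexp z + lambda * Cexp (lambda * z))%C /
    (1 + Cmod (Cexp z + Cexp (lambda * z))%C ^ 2).
Proof.
  unfold spherical_derivative.
  now rewrite (is_C_derive_unique _ _ _ (is_derive_exp_sum lambda z)).
Qed.

(** * Real frequencies *)

Lemma quotient_bound_dominant (p a b : R) :
  0 <= p -> 0 < a -> 0 < b -> 2 * b <= a \/ 2 * a <= b ->
  a + p * b <= (1 + p) * (1 + (a - b) ^ 2).
Proof.
  intros hp ha hb H.
  (* The larger of a, b is at most 2 |a - b| <= 1 + (a - b)^2. *)
  assert (a <= 1 + (a - b) ^ 2 /\ b <= 1 + (a - b) ^ 2) as [h1 h2].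
  { assert (0 <= (a - b - 1) ^ 2) by apply pow2_ge_0.
    assert (0 <= (a - b + 1) ^ 2) by apply pow2_ge_0.
    destruct H; split; nra. }
  nra.
Qed.

(** Where the exponents [x] and [r * x] differ by at least 1, one exponential
    is at least twice the other, since e >= 2; elsewhere [x] is confined to a
    bounded interval. *)
Lemma Brody_quotient_bound (r p : R) : r <> 1 -> 0 <= p ->
  exists M, forall x,
    exp x + p * exp (r * x) <= M * (1 + (exp x - exp (r * x)) ^ 2).
Proof.
  intros hr hp.
  set (X := / Rabs (r - 1)).
  assert (hpos : 0 < Rabs (r - 1)) by (apply Rabs_pos_lt; lra).
  assert (hX : 0 < X) by (now apply Rinv_0_lt_compat).
  set (N := exp X + p * exp (Rabs r * X)).
  assert (hN : 0 <= N).
  { assert (h1 := exp_pos X); assert (h2 := exp_pos (Rabs r * X)).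
    unfold N; nra. }
  assert (two : forall u v, u + 1 <= v -> 2 * exp u <= exp v).
  { intros u v huv.
    apply Rle_trans with (exp (u + 1)).
    - rewrite exp_plus.
      assert (h1 := exp_ineq1_le 1); assert (h2 := exp_pos u); nra.
    - destruct huv as [huv| ->]; [apply Rlt_le, exp_increasing, huv | lra]. }
  assert (mono : forall u v, u <= v -> exp u <= exp v).
  { intros u v [huv| ->]; [apply Rlt_le, exp_increasing, huv | lra]. }
  exists (1 + p + N); intros x.
  set (a := exp x); set (b := exp (r * x)).
  assert (ha : 0 < a) by apply exp_pos.
  assert (hb : 0 < b) by apply exp_pos.
  assert (hq : 0 <= (a - b) ^ 2) by apply pow2_ge_0.
  assert (far : 2 * b <= a \/ 2 * a <= b ->
          a + p * b <= (1 + p + N) * (1 + (a - b) ^ 2)).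
  { intros H; assert (h := quotient_bound_dominant p a b hp ha hb H); nra. }
  destruct (Rle_dec (x + 1) (r * x)) as [h1|h1].
  { apply far; right; now apply two. }
  destruct (Rle_dec (r * x + 1) x) as [h2|h2].
  { apply far; left; now apply two. }
  assert (hx : Rabs x <= X).
  { assert (Rabs (r - 1) * Rabs x <= 1).
    { rewrite <- Rabs_mult; apply Rabs_le; lra. }
    apply (Rmult_le_reg_l (Rabs (r - 1))); [exact hpos|].
    unfold X; rewrite Rinv_r; lra. }
  assert (a <= exp X).
  { apply mono, Rle_trans with (2 := hx), Rle_abs. }
  assert (b <= exp (Rabs r * X)).
  { apply mono, Rle_trans with (1 := Rle_abs _).
    rewrite Rabs_mult; apply Rmult_le_compat_l; [apply Rabs_pos | exact hx]. }
  assert (a + p * b <= N) by (unfold N; nra).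
  nra.
Qed.

Lemma spherical_derivative_bounded_real (r : R) :
  exists M, forall z,
    spherical_derivative (fun y : C => (Cexp y + Cexp (RtoC r * y))%C) z <= M.
Proof.
  destruct (Req_dec r 1) as [->|hr].
  - exists 1; intros z.
    rewrite spherical_derivative_exp_sum, !Cmult_1_l.
    set (m := Cmod _).
    assert (h0 : 0 <= (m - 1) ^ 2) by apply pow2_ge_0.
    assert (hm : 0 <= m) by apply Cmod_ge_0.
    apply Rle_div_l; nra.
  - destruct (Brody_quotient_bound r (Rabs r) hr (Rabs_pos r)) as [M HM].
    exists M; intros z.
    rewrite spherical_derivative_exp_sum.
    assert (hre : Re (RtoC r * z)%C = r * Re z)
      by (destruct z; simpl; ring).
    specialize (HM (Re z)).
    rewrite <- hre, <- !Cmod_Cexp in HM.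
    set (u := Cexp z) in *; set (v := Cexp (RtoC r * z)) in *.
    apply Rle_div_l.
    { assert (h := pow2_ge_0 (Cmod (u + v)%C)); lra. }
    assert (hnum : Cmod (u + RtoC r * v)%C <= Cmod u + Rabs r * Cmod v).
    { rewrite <- (Cmod_R r), <- Cmod_mult; apply Cmod_triangle. }
    assert (hden : (Cmod u - Cmod v) ^ 2 <= Cmod (u + v)%C ^ 2).
    { assert (h1 : Cmod u <= Cmod (u + v)%C + Cmod v).
      { rewrite <- (Cmod_opp v).
        replace u with (u + v + - v)%C at 1 by ring; apply Cmod_triangle. }
      assert (h2 : Cmod v <= Cmod (u + v)%C + Cmod u).
      { rewrite <- (Cmod_opp u).
        replace v with (u + v + - u)%C at 1 by ring; apply Cmod_triangle. }
      apply pow_maj_Rabs, Rabs_le; lra. }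
    assert (hM : 0 <= M).
    { assert (h1 := Cmod_ge_0 u); assert (h2 := Cmod_ge_0 v).
      assert (h3 := pow2_ge_0 (Cmod u - Cmod v)).
      assert (h4 := Rabs_pos r).
      assert (0 <= Rabs r * Cmod v) by (now apply Rmult_le_pos).
      destruct (Rle_dec 0 M); nra. }
    nra.
Qed.

(** * Non-real frequencies *)

Lemma spherical_derivative_at_zero (lambda z : C) :
  Cexp ((lambda - 1) * z) = (- (1))%C ->
  spherical_derivative (fun y : C => (Cexp y + Cexp (lambda * y))%C) z =
  Cmod (lambda - 1)%C * exp (Re z).
Proof.
  intros H.
  rewrite spherical_derivative_exp_sum.
  replace (lambda * z)%C with (z + (lambda - 1) * z)%C by ring.
  rewrite Cexp_plus, H.
  replace (Cexp z + Cexp z * - (1))%C with (RtoC 0) by ring.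
  replace (Cexp z + lambda * (Cexp z * - (1)))%C
    with (- ((lambda - 1) * Cexp z))%C by ring.
  rewrite Cmod_0, Cmod_opp, Cmod_mult, Cmod_Cexp.
  field.
Qed.

Lemma Cexp_odd_PI (n : nat) (t : R) :
  Rabs t = INR (2 * n + 1) * PI -> Cexp (0, t) = (- (1))%C.
Proof.
  intros ht.
  assert (hc : cos (INR (2 * n + 1) * PI) = -1).
  { rewrite plus_INR, mult_INR.
    replace (_ * PI) with (PI + 2 * INR n * PI) by (simpl; ring).
    rewrite cos_period; apply cos_PI. }
  assert (hct : cos t = -1).
  { rewrite <- hc, <- ht; unfold Rabs; destruct (Rcase_abs t);
      [now rewrite cos_neg | easy]. }
  assert (hst : sin t = 0).
  { apply Rsqr_0_uniq; rewrite sin2, hct; unfold Rsqr; ring. }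
  unfold Cexp; simpl; rewrite hct, hst, exp_0.
  apply injective_projections; simpl; ring.
Qed.

(** The zeros used are [i t / mu] with [mu = lambda - 1] and [t] an odd multiple
    of PI carrying the sign of [Im mu], so that their real part
    [t * Im mu / |mu|^2] is positive. *)
Lemma spherical_derivative_unbounded (lambda : C) :
  Im lambda <> 0 ->
  forall M, exists z,
    M < spherical_derivative (fun y : C => (Cexp y + Cexp (lambda * y))%C) z.
Proof.
  intros him M.
  set (mu := (lambda - 1)%C).
  assert (hmi : Im mu <> 0).
  { unfold mu; destruct lambda as [p q]; simpl in *.
    now replace (q + - 0) with q by ring. }
  assert (hmu : mu <> 0%C) by (intros E; now rewrite E in hmi).
  set (m := Cmod mu).
  assert (hm : 0 < m) by (now apply Cmod_gt_0).
  set (s := Rabs (Im mu)).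
  assert (hs : 0 < s) by (now apply Rabs_pos_lt).
  set (g := m * (s / m ^ 2)).
  assert (hg : 0 < g).
  { apply Rmult_lt_0_compat; [easy|].
    apply Rdiv_lt_0_compat; [easy | now apply pow_lt]. }
  destruct (INR_unbounded (Rabs M / g)) as [n hn].
  set (T := INR (2 * n + 1) * PI).
  assert (hT : INR n <= T).
  { assert (h := PI2_1); assert (h0 := pos_INR n).
    unfold T; rewrite plus_INR, mult_INR; simpl; nra. }
  assert (ht : exists t, Rabs t = T /\ t * Im mu = T * s).
  { assert (hT0 : 0 <= T) by (assert (h0 := pos_INR n); lra).
    destruct (Rcase_abs (Im mu)) as [h|h].
    - exists (- T); split; [rewrite Rabs_Ropp; now apply Rabs_pos_eq|].
      unfold s; rewrite Rabs_left by exact h; ring.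
    - exists T; split; [now apply Rabs_pos_eq|].
      unfold s; now rewrite Rabs_right. }
  destruct ht as [t [ht1 ht2]].
  set (z := ((0, t) / mu)%C).
  exists z.
  rewrite spherical_derivative_at_zero; fold mu.
  2: { unfold z, Cdiv.
       rewrite (Cmult_comm (0, t)), Cmult_assoc, Cinv_r, Cmult_1_l by easy.
       now apply (Cexp_odd_PI n). }
  assert (hre : Re z = T * (s / m ^ 2)).
  { replace (T * (s / m ^ 2)) with (t * Im mu / m ^ 2)
      by (rewrite ht2; unfold Rdiv; ring).
    unfold z, m; rewrite Cmod2_alt.
    destruct mu as [u v]; unfold Re, Im in *; simpl in *.
    field; nra. }
  fold m.
  assert (he := exp_ineq1_le (Re z)).
  assert (hlt : Rabs M < T * g).
  { apply (Rmult_lt_compat_r g) in hn; [|easy].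
    unfold Rdiv in hn; rewrite Rmult_assoc, Rinv_l, Rmult_1_r in hn by lra.
    nra. }
  assert (hM := Rle_abs M).
  assert (T * g = m * Re z) by (rewrite hre; unfold g; ring).
  nra.
Qed.

Theorem proposition3 (lambda : C) :
  entire (fun z : C => (Cexp z + Cexp (lambda * z))%C) /\
  (Brody (fun z : C => (Cexp z + Cexp (lambda * z))%C) <->
   exists r : R, lambda = RtoC r).
Proof.
  assert (He : entire (fun z : C => (Cexp z + Cexp (lambda * z))%C)).
  { intros z; eexists; apply is_derive_exp_sum. }
  split; [exact He|split].
  - intros [_ [M HM]].
    exists (Re lambda).
    destruct (Req_dec (Im lambda) 0) as [h|h].
    + apply injective_projections; [easy | exact h].
    + destruct (spherical_derivative_unbounded lambda h M) as [z hz].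
      specialize (HM z); lra.
  - intros [r ->]; split; [exact He|].
    apply spherical_derivative_bounded_real.
Qed.
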